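(* Let $G=(V,E)$ be a finite connected graph and let $\beta\in\mathcal{P}(E)$. Then $G$ is strictly $\beta$-dense if and only if $G$ is strictly $\beta$-homogeneous and biconnected.
   Context: $G=(V,E)$ is a finite connected undirected graph; multi-edges are allowed, self-loops are not. $\Gamma$ is the set of all spanning trees of $G$ (viewed as edge sets). $\mathcal{P}(X)$ is the set of probability mass functions on a finite set $X$. For $\sigma\in\mathbb{R}^E_{>0}$ and $\gamma\in\Gamma$, $\sigma[\gamma]=\prod_{e\in\gamma}\sigma(e)$, and $\mu_\sigma\in\mathcal{P}(\Gamma)$ is the pmf $\mu_\sigma(\gamma)=\sigma[\gamma]/\sum_{\gamma'\in\Gamma}\sigma[\gamma']$. For $\mu\in\mathcal{P}(\Gamma)$, $\eta_\mu(e)=\sum_{\gamma\in\Gamma,\,\gamma\ni e}\mu(\gamma)$. $G$ is strictly $\beta$-homogeneous if there exists $\sigma\in\mathbb{R}^E_{>0}$ with $\eta_{\mu_\sigma}(e)/(|V|-1)=\beta(e)$ for all $e\in E$. $\mathcal{S}(G)$ is the family of all connected subgraphs $H=(V_H,E_H)$ of $G$ with $|E_H|\ge 1$ that are edge-induced, i.e. obtained by removing all edges of $E\setminus E_H$ from $G$ and deleting any vertices of degree zero. For $H\in\mathcal{S}(G)$, $\theta_\beta(H)=\beta(E_H)/(|V_H|-1)$, where $\beta(E_H)=\sum_{e\in E_H}\beta(e)$. $G$ is strictly $\beta$-dense if $\theta_\beta(H)<\theta_\beta(G)$ for all $H\in\mathcal{S}(G)$ with $H\neq G$. Biconnected means vertex-biconnected: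 $G$ is connected and has no articulation (cut) vertex; in particular a graph with two vertices joined by one or more edges is biconnected. *)

(* Defs.v *)
From mathcomp Require Import all_boot all_order all_algebra.
From mathcomp Require Import boolp reals.

Set Implicit Arguments.
Unset Strict Implicit.
Unset Printing Implicit Defensive.

Import Order.TTheory GRing.Theory Num.Theory.
Local Open Scope ring_scope.

(* Distinct edges may have the same endpoints; [card_ends] excludes loops. *)
Record multigraph := Multigraph {
  vertex : finType;
  edge : finType;
  ends : edge -> {set vertex};
  card_ends : forall e, #|ends e| = 2 }.

(* A subgraph is a pair (vertices, edges). That its edges have their endpoints
   among its vertices is not part of the type; it holds for each of
   [whole_graph], [delete_vertex] and the members of [edge_induced]. *)
Definition subgraph (G : multigraph) : Type :=
  ({set vertex G} * {set edge G})%type.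

Definition whole_graph (G : multigraph) : subgraph G := ([set: _], [set: _]).

Definition delete_vertex (G : multigraph) (v : vertex G) : subgraph G :=
  ([set~ v], [set e | v \notin ends e]).

Definition adjacent_by (G : multigraph) (F : {set edge G}) : rel (vertex G) :=
  fun x y => [exists e in F, ends e == [set x; y]].

Definition subgraph_connected (G : multigraph) (H : subgraph G) : Prop :=
  H.1 != set0 /\ {in H.1 &, forall x y, connect (adjacent_by H.2) x y}.

Definition graph_connected (G : multigraph) : Prop :=
  subgraph_connected (whole_graph G).

Definition articulation_vertex (G : multigraph) (v : vertex G) : Prop :=
  exists x y : vertex G,
    [/\ x != v, y != v,
        connect (adjacent_by (whole_graph G).2) x y
      & ~~ connect (adjacent_by (delete_vertex v).2) x y].

Definition graph_biconnected (G : multigraph) : Prop :=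
  graph_connected G /\ forall v : vertex G, ~ articulation_vertex v.

(* A simple cycle is listed as (v_1, e_1), ..., (v_k, e_k), where e_i joins v_i
   to v_(i+1) and e_k joins v_k to v_1. There are no loops, so k = 1 is
   impossible; k = 2 is a pair of parallel edges. *)
Definition graph_cycle (G : multigraph) (c : seq (vertex G * edge G)) : Prop :=
  [/\ c != [::], uniq (map fst c), uniq (map snd c)
    & cycle (fun p q => ends p.2 == [set p.1; q.1]) c].

Definition edge_acyclic (G : multigraph) (F : {set edge G}) : Prop :=
  forall c : seq (vertex G * edge G),
    graph_cycle c -> ~ {subset map snd c <= F}.

Definition spanning_tree (G : multigraph) (g : {set edge G}) : Prop :=
  subgraph_connected ([set: vertex G], g) /\ edge_acyclic g.

Definition spanning_trees (G : multigraph) : {set {set edge G}} :=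
  [set g | `[< spanning_tree g >]].

Definition prob_mass (R : realType) (X : finType) (p : X -> R) : Prop :=
  (forall x, 0 <= p x) /\ \sum_x p x = 1.

Definition tree_weight (R : realType) (G : multigraph) (sigma : edge G -> R)
    (g : {set edge G}) : R :=
  \prod_(e in g) sigma e.

(* Only the values at spanning trees are meaningful. *)
Definition tree_pmf (R : realType) (G : multigraph) (sigma : edge G -> R)
    (g : {set edge G}) : R :=
  tree_weight sigma g / \sum_(g' in spanning_trees G) tree_weight sigma g'.

Definition edge_marginal (R : realType) (G : multigraph)
    (mu : {set edge G} -> R) (e : edge G) : R :=
  \sum_(g in spanning_trees G | e \in g) mu g.

Definition strictly_homogeneous (R : realType) (G : multigraph)
    (beta : edge G -> R) : Prop :=
  exists sigma : edge G -> R,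
    (forall e, 0 < sigma e) /\
    (forall e, edge_marginal (tree_pmf sigma) e / (#|vertex G|%:R - 1)
               = beta e).

Definition edge_induced (G : multigraph) (H : subgraph G) : Prop :=
  H.1 = \bigcup_(e in H.2) ends e.

Definition connected_edge_induced (G : multigraph) (H : subgraph G) : Prop :=
  [/\ edge_induced H, subgraph_connected H & (1 <= #|H.2|)%N].

Definition theta (R : realType) (G : multigraph) (beta : edge G -> R)
    (H : subgraph G) : R :=
  (\sum_(e in H.2) beta e) / (#|H.1|%:R - 1).

Definition strictly_dense (R : realType) (G : multigraph)
    (beta : edge G -> R) : Prop :=
  forall H : subgraph G, connected_edge_induced H -> H <> whole_graph G ->
    theta beta H < theta beta (whole_graph G).

(* Main.v *)
Require Import Defs.
From mathcomp Require Import boolp classical_sets functions topology normedtype.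
From mathcomp Require Import sequences derive realfun exp.
From mathcomp Require Import all_boot all_order all_algebra.
From mathcomp Require Import reals.
From mathcomp Require Import zify lra.

(** Write [n] for the number of vertices, [eta = (n - 1) beta], and
    [r F = n - c F] for the rank of an edge set [F] in the cycle matroid of the
    graph, [c F] being the number of connected components of the graph on all
    the vertices with edge set [F].

    Suppose the graph is strictly dense. An edge set [F], neither empty nor
    full, is the disjoint union of the edge sets of its components; applying
    density to each component with an edge gives [eta F < r F]
    ([dense_rank_lt]). If some [v] were an articulation vertex, the edges that
    meet one component of [G - v] and the remaining edges would be two such
    sets, with ranks adding up to at most [n - 1 = eta E], a contradiction
    ([dense_biconnected]). For homogeneity, look for [sigma = exp theta] with
    [theta] a critical point of

      [Phi theta = \sum_g expR (\sum_e ((e \in g) - eta e) * theta e)],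

    where [g] ranges over the spanning trees: the vanishing of the partial
    derivative at [e] says exactly that [e] has marginal [eta e]. Kruskal's
    algorithm, run on the edges in decreasing order of [theta], yields a tree
    meeting every prefix [F] of this order in [r F] edges
    ([greedy_spanning_tree]). Since [r F - eta F] is bounded below by some
    [delta > 0], summation by parts shows that the exponent of this tree is at
    least [delta * (max theta - min theta)] ([greedy_tree_bound]). Hence [Phi],
    which is unchanged when a constant is added to [theta], attains its minimum
    ([exp_sum_critical_point]).

    Conversely, suppose that the marginals of a positive [sigma] are [eta] and
    that the graph is biconnected, and let [H] be a connected edge-induced
    subgraph with vertex set [W] and edge set [S], neither edgeless nor the
    whole graph. Then [eta S] is the mean of [#|g :&: S|] over the random
    spanning tree [g]. Always [#|g :&: S| <= #|W| - 1]. A tree built greedily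
    from the edges outside [S] first has [#|g :&: S| = c (~: S) - 1], and
    biconnectedness gives [c (~: S) < #|W|] ([biconnected_components_lt]), so
    the inequality is strict for that tree, which has positive probability. *)

Set Implicit Arguments.
Unset Strict Implicit.
Unset Printing Implicit Defensive.

Import Order.TTheory GRing.Theory Num.Theory.
Import numFieldNormedType.Exports.

(** * Connectivity under an edge set *)

Lemma adjacent_by_sym (G : multigraph) (F : {set edge G}) :
  symmetric (adjacent_by F).
Proof. by move=> x y; apply: eq_existsb => e; rewrite setUC. Qed.

Lemma connect_adjacent_sym (G : multigraph) (F : {set edge G}) :
  connect_sym (adjacent_by F).
Proof. exact/sym_connect_sym/adjacent_by_sym. Qed.

Lemma adjacent_byS (G : multigraph) (F F' : {set edge G}) :
  F \subset F' -> subrel (adjacent_by F) (adjacent_by F').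
Proof.
move=> /subsetP sFF' x y /existsP[e /andP[eF exy]].
by apply/existsP; exists e; rewrite sFF'.
Qed.

Lemma connect_adjacentS (G : multigraph) (F F' : {set edge G}) :
  F \subset F' -> subrel (connect (adjacent_by F)) (connect (adjacent_by F')).
Proof.
move=> sFF'; apply: connect_sub => x y /(adjacent_byS sFF'); exact: connect1.
Qed.

Lemma ends_pair (G : multigraph) (e : edge G) :
  exists a b, a != b /\ ends e = [set a; b].
Proof.
by have /eqP/cards2P[a [b [ab ->]]] := card_ends e; exists a, b.
Qed.

Lemma adjacent_by_ends (G : multigraph) (F : {set edge G}) e x y :
  e \in F -> x \in ends e -> y \in ends e -> connect (adjacent_by F) x y.
Proof.
move=> eF; have [a [b [ab eE]]] := ends_pair e.
rewrite eE !inE => /orP[]/eqP-> /orP[]/eqP-> //; apply: connect1;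
  by apply/existsP; exists e; rewrite eF eE //= setUC.
Qed.

Lemma adjacent_byP (G : multigraph) (F : {set edge G}) x y :
  adjacent_by F x y -> exists e, [/\ e \in F, x \in ends e & y \in ends e].
Proof.
case/existsP=> e /andP[eF /eqP exy]; exists e.
by rewrite exy !inE !eqxx orbT.
Qed.

(** A vertex set left by no edge of [F] is a union of components of [F]. *)
Lemma connect_invariant (G : multigraph) (F : {set edge G}) (U : {set vertex G})
    x y :
    (forall e a b, e \in F -> a \in ends e -> b \in ends e ->
       a \in U -> b \in U) ->
  connect (adjacent_by F) x y -> x \in U -> y \in U.
Proof.
move=> clU cxy xU.
rewrite -(@closed_connect _ (adjacent_by F) (mem U) _ _ _ cxy) //.
apply: (intro_closed (@connect_adjacent_sym G F)) => a b.
by case/adjacent_byP=> e [eF ae be]; apply: clU eF ae be.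
Qed.

(** * Components and rank *)

(** The component of [x] in the graph on all the vertices with edge set [F]. *)
Definition component (G : multigraph) (F : {set edge G}) (x : vertex G) :
  {set vertex G} := [set y | connect (adjacent_by F) x y].

(** Isolated vertices count as components. *)
Definition components (G : multigraph) (F : {set edge G}) :
  {set {set vertex G}} := [set component F x | x : vertex G].

(** The rank of [F] in the cycle matroid of [G]. The subtraction is not
    truncated, by [rank_components]. *)
Definition graph_rank (G : multigraph) (F : {set edge G}) : nat :=
  #|vertex G| - #|components F|.

Lemma component_refl (G : multigraph) (F : {set edge G}) x :
  x \in component F x.
Proof. by rewrite inE connect0. Qed.

Lemma component_eq (G : multigraph) (F : {set edge G}) x y :
  (component F x == component F y) = connect (adjacent_by F) x y.
Proof.
apply/eqP/idP => [exy|cxy].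
  by have := component_refl F y; rewrite -exy inE.
by apply/setP=> z; rewrite !inE (same_connect (@connect_adjacent_sym G F) cxy).
Qed.

Lemma rank_components (G : multigraph) (F : {set edge G}) :
  graph_rank F + #|components F| = #|vertex G|.
Proof. by rewrite subnK // leq_imset_card. Qed.

Lemma connect_setU1 (G : multigraph) (F : {set edge G}) e a b x y :
    ends e = [set a; b] ->
  connect (adjacent_by (e |: F)) x y =
  [|| connect (adjacent_by F) x y,
      connect (adjacent_by F) x a && connect (adjacent_by F) b y
    | connect (adjacent_by F) x b && connect (adjacent_by F) a y].
Proof.
move=> eE; have sF : F \subset e |: F by apply: subsetUr.
have cU u v : connect (adjacent_by F) u v -> connect (adjacent_by (e |: F)) u v.
  exact: connect_adjacentS.
have cab : connect (adjacent_by (e |: F)) a b.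
  by apply: (@adjacent_by_ends G _ e); rewrite ?eE !inE ?eqxx ?orbT.
have cba : connect (adjacent_by (e |: F)) b a by rewrite connect_adjacent_sym.
apply/idP/idP; last first.
  case/or3P=> [/cU //|/andP[/cU xa /cU by_]|/andP[/cU xb /cU ay]].
    exact: connect_trans xa (connect_trans cab by_).
  exact: connect_trans xb (connect_trans cba ay).
pose U := [set z | [|| connect (adjacent_by F) x z,
      connect (adjacent_by F) x a && connect (adjacent_by F) b z
    | connect (adjacent_by F) x b && connect (adjacent_by F) a z]].
move=> cxy; suff : y \in U by rewrite inE.
apply: (connect_invariant _ cxy); last by rewrite inE connect0.
move=> f u v; rewrite !inE => /predU1P[->|fF] uf vf; last first.
  have cuv := adjacent_by_ends fF uf vf.
  have st z : connect (adjacent_by F) z u -> connect (adjacent_by F) z v.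
    by move=> zu; apply: connect_trans zu cuv.
  by case/or3P=> [/st->//|/andP[-> /st->]|/andP[-> /st->]]; rewrite ?orbT.
have cs p q : connect (adjacent_by F) p q -> connect (adjacent_by F) q p.
  by rewrite connect_adjacent_sym.
move: uf vf; rewrite eE !inE => /orP[]/eqP-> /orP[]/eqP-> //.
- by case/or3P=> [->|/andP[-> _]|/andP[-> _]]; rewrite ?connect0 ?orbT.
- by case/or3P=> [->|/andP[-> _]|/andP[-> _]]; rewrite ?connect0 ?orbT.
Qed.

Lemma rank_setU1 (G : multigraph) (F : {set edge G}) e a b :
    ends e = [set a; b] ->
  graph_rank (e |: F) = graph_rank F + ~~ connect (adjacent_by F) a b.
Proof.
move=> eE.
suff cE : #|components F| =
    #|components (e |: F)| + ~~ connect (adjacent_by F) a b.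
  by have := rank_components F; have := rank_components (e |: F); lia.
have cs p q : connect (adjacent_by F) p q -> connect (adjacent_by F) q p.
  by rewrite connect_adjacent_sym.
have [cab|ncab] /= := boolP (connect (adjacent_by F) a b).
  rewrite addn0; congr #|pred_of_set _|; apply: eq_imset => x.
  apply/setP=> y; rewrite !inE (connect_setU1 F x y eE).
  apply/idP/idP => [->//|/or3P[//|/andP[xa by_]|/andP[xb ay]]].
    exact: connect_trans xa (connect_trans cab by_).
  exact: connect_trans xb (connect_trans (cs _ _ cab) ay).
(* Each component of [e |: F] is reached from exactly one component of [F]
   other than that of [b]. *)
pose phi (X : {set vertex G}) := \bigcup_(x in X) component (e |: F) x.
have phiE x : phi (component F x) = component (e |: F) x.
  apply/setP=> y; apply/bigcupP/idP => [[z]|xy]; last first.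
    by exists x => //; rewrite component_refl.
  rewrite !inE => xz; apply: connect_trans.
  by apply: connect_adjacentS xz; apply: subsetUr.
have bF : component F b \in components F by apply: imset_f.
rewrite (cardsD1 (component F b)) bF addnC; congr (_ + _).
have -> : components (e |: F) = phi @: (components F :\ component F b).
  apply/setP=> X; apply/imsetP/imsetP
    => [[x _ ->]|[Y /setD1P[_ /imsetP[x _ ->]] ->]];
    last by exists x => //; rewrite phiE.
  have [cxb|ncxb] := boolP (connect (adjacent_by F) x b).
    exists (component F a).
      by rewrite !inE component_eq ncab imset_f.
    rewrite phiE; apply/eqP; rewrite component_eq (connect_setU1 F x a eE).
    by rewrite cxb connect0 !orbT.
  exists (component F x); last by rewrite phiE.
  by rewrite !inE component_eq ncxb imset_f.
rewrite card_in_imset // => X Y.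
move=> /setD1P[Xb /imsetP[x _ XE]] /setD1P[Yb /imsetP[y _ YE]].
rewrite {}XE {}YE !phiE in Xb Yb * => /eqP.
rewrite !component_eq in Xb Yb *; rewrite (connect_setU1 F x y eE) => cxy.
apply/eqP; rewrite component_eq; case/or3P: cxy => // /andP[].
  by move=> _ /cs; rewrite (negPf Yb).
by rewrite (negPf Xb).
Qed.

Lemma rank_set0 (G : multigraph) : graph_rank (@set0 (edge G)) = 0.
Proof.
apply/eqP; rewrite subn_eq0 card_imset // => x y /eqP.
rewrite component_eq => cxy; apply: esym; apply/set1P.
apply: (connect_invariant _ cxy); last exact: set11.
by move=> e a b; rewrite in_set0.
Qed.

Lemma rank_le_card (G : multigraph) (F : {set edge G}) : graph_rank F <= #|F|.
Proof.
elim: {F}#|F| {-2}F (erefl #|F|) => [|n IH] F.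
  by move/eqP; rewrite cards_eq0 => /eqP->; rewrite rank_set0.
move=> cF; have /card_gt0P[e eF] : 0 < #|F| by rewrite cF.
have [a [b [_ eE]]] := ends_pair e.
have cF' : #|F :\ e| = n by move: cF; rewrite (cardsD1 e) eF; lia.
have := IH _ cF'; rewrite -(setD1K eF) (rank_setU1 (F :\ e) eE) setD1K // cF.
by case: (~~ _); lia.
Qed.

(** Each vertex outside [U] is a component by itself, and [U] meets at least one
    further component. *)
Lemma rank_lt_support (G : multigraph) (F : {set edge G}) (U : {set vertex G}) :
    U != set0 -> (forall e, e \in F -> ends e \subset U) ->
  graph_rank F < #|U|.
Proof.
case/set0Pn=> u uU FU.
suff : #|~: U| < #|components F|.
  by have := rank_components F; have := cardsC U; lia.
have <- : #|u |: ~: U| = #|~: U|.+1 by rewrite cardsU1 inE uU.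
have isol x y : x \notin U -> connect (adjacent_by F) x y -> y = x.
  move=> xU cxy; apply/set1P.
  apply: (connect_invariant _ cxy); last exact: set11.
  move=> e a b eF ae _ /set1P ax.
  by move: xU; rewrite -ax (subsetP (FU e eF)).
rewrite -(@card_in_imset _ _ (component F) (u |: ~: U)).
  apply/subset_leq_card/subsetP => _ /imsetP[x _ ->]; exact: imset_f.
move=> x y; rewrite !inE => xU yU /eqP; rewrite component_eq => cxy.
case/predU1P: xU => [xu|xU]; last by rewrite (isol x y xU cxy).
case/predU1P: yU => [->//|yU].
by apply: isol => //; rewrite connect_adjacent_sym.
Qed.

(** * Acyclic edge sets and spanning trees *)

(** A path with distinct vertices, with an edge of [F] chosen at each step; [q]
    stands for the end of the path, together with an arbitrary edge. *)
Lemma path_edges (G : multigraph) (F : {set edge G}) x p :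
    path (adjacent_by F) x p -> uniq (x :: p) ->
  exists c : seq (vertex G * edge G),
    [/\ map fst c = belast x p, uniq (map snd c),
        {subset map snd c <= F},
        (forall e, e \in map snd c -> ends e \subset x :: p)
      & forall q, q.1 = last x p ->
          sorted (fun p q => ends p.2 == [set p.1; q.1]) (rcons c q)].
Proof.
elim: p x => [|y p IH] x /=; first by exists [::].
case/andP=> /existsP[e /andP[eF /eqP eE]] yp /andP[xyp uyp].
have [c [c1 c2 c3 c4 c5]] := IH y yp uyp.
exists ((x, e) :: c); split=> /=.
- by rewrite c1.
- rewrite c2 andbT; apply/negP=> /c4/subsetP/(_ x).
  by rewrite eE set21 (negPf xyp) => /(_ isT).
- by move=> f; rewrite inE => /predU1P[->//|]; apply: c3.
- move=> f; rewrite inE => /predU1P[->|/c4 fyp].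
    by rewrite eE; apply/subsetP=> z; rewrite !inE => /orP[]->; rewrite ?orbT.
  apply: subset_trans fyp _; apply/subsetP=> z.
  by rewrite !inE => ->; rewrite orbT.
- move=> q qE; have {c5}/= := c5 q qE.
  case: c c1 {c2 c3 c4} => [|r c] /= c1.
    by case: p c1 qE {IH yp xyp uyp} => //= _ ->; rewrite eE eqxx.
  case: p c1 {IH yp xyp uyp qE} => //= z p [-> _].
  by rewrite eE eqxx.
Qed.

Lemma edge_acyclicS (G : multigraph) (F F' : {set edge G}) :
  F \subset F' -> edge_acyclic F' -> edge_acyclic F.
Proof.
move=> /subsetP sFF' aF' c cc cF; apply: aF' cc _ => e /cF; exact: sFF'.
Qed.

Lemma acyclic_not_connect (G : multigraph) (F : {set edge G}) e a b :
    edge_acyclic (e |: F) -> e \notin F -> ends e = [set a; b] ->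
  ~~ connect (adjacent_by F) a b.
Proof.
move=> aF eF eE; apply/negP=> /connectP[p pF bE].
case/shortenP: pF bE => q qF uq _ bE.
have [c [c1 c2 c3 _ c5]] := path_edges qF uq.
apply: (aF ((b, e) :: c)); last first.
  by move=> f /=; rewrite !inE => /predU1P[->|/c3 ->]; rewrite ?eqxx ?orbT.
split=> //=.
- by rewrite c1 bE -rcons_uniq -lastI.
- by rewrite c2 andbT; apply: contra eF; exact: c3.
- have := c5 (b, e) bE.
  case: q c1 {qF uq c5} bE => [|z q] /=.
    by move=> _ bE; have := card_ends e; rewrite eE bE setUid cards1.
  by case: c {c2 c3} => //= r c [ra _] _ ->; rewrite eE ra setUC eqxx.
Qed.

Lemma edge_path_connect (G : multigraph) (F : {set edge G}) r c q :
    path (fun p q : vertex G * edge G => ends p.2 == [set p.1; q.1]) r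
      (rcons c q) ->
    {subset map snd (r :: c) <= F} ->
  connect (adjacent_by F) r.1 q.1.
Proof.
elim: c r => [|s c IH] r /= /andP[rs sc] cF.
  apply: connect1; apply/existsP; exists r.2.
  by rewrite cF ?mem_head.
apply: (@connect_trans _ _ s.1).
  apply: connect1; apply/existsP; exists r.2.
  by rewrite cF ?mem_head.
by apply: IH sc _ => e ec; apply: cF; rewrite inE ec orbT.
Qed.

Lemma acyclic_of_rank (G : multigraph) (F : {set edge G}) :
  graph_rank F = #|F| -> edge_acyclic F.
Proof.
move=> rF [|[v e] c] [// _ _ /=]/andP[ec uc] cyc cF.
have eF : e \in F by apply: cF; rewrite mem_head.
have [a [b [ab eE]]] := ends_pair e.
suff cab : connect (adjacent_by (F :\ e)) a b.
  have := rank_le_card (F :\ e); move: rF.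
  by rewrite -{1}(setD1K eF) (rank_setU1 _ eE) cab (cardsD1 e F) eF; lia.
case: c ec uc cyc cF => [|r c] ec uc /= /andP[/eqP vr rc] cF.
  by have := card_ends e; rewrite vr setUid cards1.
have crv : connect (adjacent_by (F :\ e)) r.1 v.
  apply: (edge_path_connect rc) => f fc; rewrite !inE cF ?andbT.
    by apply: contraNneq ec => <-.
  by rewrite inE fc orbT.
have : a \in [set v; r.1] by rewrite -vr eE set21.
have : b \in [set v; r.1] by rewrite -vr eE set22.
rewrite !inE => /orP[]/eqP bE /orP[]/eqP aE; rewrite aE bE ?connect0 //.
by rewrite connect_adjacent_sym.
Qed.

Lemma rank_acyclic (G : multigraph) (F : {set edge G}) :
  edge_acyclic F -> graph_rank F = #|F|.
Proof.
elim: {F}#|F| {-2}F (erefl #|F|) => [|n IH] F.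
  by move/eqP; rewrite cards_eq0 => /eqP-> _; rewrite rank_set0 cards0.
move=> cF aF; have /card_gt0P[e eF] : 0 < #|F| by rewrite cF.
have [a [b [_ eE]]] := ends_pair e.
have cF' : #|F :\ e| = n by move: cF; rewrite (cardsD1 e) eF; lia.
rewrite -(setD1K eF) (rank_setU1 _ eE) setD1K // IH ?cF ?cF' //; last first.
  exact: edge_acyclicS (subD1set _ _) aF.
by rewrite (@acyclic_not_connect _ _ e) ?setD1K ?setD11 // addn1.
Qed.

Lemma rank_connected (G : multigraph) (F : {set edge G}) :
  subgraph_connected ([set: vertex G], F) <-> (graph_rank F).+1 = #|vertex G|.
Proof.
have rc := rank_components F; split=> [[/set0Pn[/= x _] cF]|rF].
  suff c1 : #|components F| = 1 by rewrite -rc c1 addn1.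
  apply/eqP/cards1P; exists (component F x); apply/setP=> X; rewrite inE.
  apply/imsetP/eqP => [[y _ ->]|->]; last by exists x.
  by apply/eqP; rewrite component_eq; apply: cF; rewrite inE.
have /eqP/cards1P[X cX] : #|components F| = 1.
  by apply/eqP; rewrite -(eqn_add2l (graph_rank F)) rc addn1 rF.
have cE x : component F x = X.
  by apply/set1P; rewrite -cX imset_f.
split=> [|x y _ _] /=; last by rewrite -component_eq !cE.
have : X \in components F by rewrite cX set11.
by case/imsetP=> x _ _; apply/set0Pn; exists x; rewrite inE.
Qed.

Lemma spanning_treeP (G : multigraph) (g : {set edge G}) :
  spanning_tree g <-> graph_rank g = #|g| /\ #|g|.+1 = #|vertex G|.
Proof.
split=> [[/rank_connected rg /rank_acyclic ag]|[rg cg]].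
  by rewrite -{2}ag.
by split; [apply/rank_connected; rewrite rg|exact: acyclic_of_rank].
Qed.

(** Kruskal's algorithm: an edge of [s] is kept if it joins two components of
    the set of the edges that precede it. *)
Lemma greedy_forest (G : multigraph) (s : seq (edge G)) :
  exists g : {set edge G}, [/\ g \subset [set:: s], graph_rank g = #|g|
    & forall k, #|g :&: [set:: take k s]| = graph_rank [set:: take k s]].
Proof.
elim/last_ind: s => [|s e [g [gs rg gk]]].
  exists set0; rewrite sub0set cards0 rank_set0; split=> // k.
  by rewrite set0I cards0.
have sE : [set:: rcons s e] = e |: [set:: s].
  by apply/setP=> f; rewrite !inE mem_rcons inE.
have gS : #|g| = graph_rank [set:: s].
  by have := gk (size s); rewrite take_size (setIidPl gs).
have [a [b [_ eE]]] := ends_pair e.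
have rE := rank_setU1 [set:: s] eE.
have tE k : take k (rcons s e) = if k <= size s then take k s else rcons s e.
  case: leqP => ks; last by rewrite take_oversize // size_rcons.
  by rewrite -cats1 takel_cat.
have [cab|ncab] := boolP (connect (adjacent_by [set:: s]) a b).
  rewrite cab addn0 in rE.
  have ge : g \subset [set:: rcons s e].
    by rewrite sE; apply: subset_trans gs (subsetUr _ _).
  exists g; split=> // k; rewrite tE; case: ifP => // _.
  by rewrite (setIidPl ge) sE rE.
rewrite ncab addn1 in rE.
have es : e \notin [set:: s].
  apply: contra ncab => es; apply: (adjacent_by_ends es);
  by rewrite eE !inE eqxx ?orbT.
have eg : e \notin g by apply: contra es => /(subsetP gs).
have ge : e |: g \subset [set:: rcons s e] by rewrite sE setUS.
have reg : graph_rank (e |: g) = #|e |: g|.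
  rewrite (rank_setU1 _ eE) cardsU1 eg rg addnC.
  by rewrite (contra (@connect_adjacentS _ _ _ gs _ _) ncab).
exists (e |: g); split=> // k; rewrite tE; case: ifP => _.
  rewrite -gk; congr #|pred_of_set _|; apply/setP=> f; rewrite !inE.
  have [->|//] := eqVneq f e; rewrite (negPf eg) /=.
  by apply/negbTE; apply: contra es => /mem_take; rewrite inE.
by rewrite (setIidPl ge) sE rE -gS cardsU1 eg.
Qed.

Lemma greedy_spanning_tree (G : multigraph) (s : seq (edge G)) :
    graph_connected G -> (forall e, e \in s) ->
  exists2 g : {set edge G}, spanning_tree g
    & forall k, #|g :&: [set:: take k s]| = graph_rank [set:: take k s].
Proof.
move=> cG sT; have [g [gs rg gk]] := greedy_forest s; exists g => //.
have sE : [set:: s] = [set: edge G] by apply/setP=> e; rewrite !inE sT.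
have := gk (size s); rewrite take_size sE setIT => gT.
apply/spanning_treeP; split=> //; rewrite gT.
exact/rank_connected.
Qed.

Local Open Scope ring_scope.

(** * Critical points of sums of exponentials *)

(** Summation by parts for a nonincreasing sequence [t]. *)
Lemma abel_lower_bound (R : realDomainType) (d t : nat -> R) (delta : R) m :
    (forall i, (i < m)%N -> t i.+1 <= t i) ->
    (forall k, (0 < k <= m)%N -> delta <= \sum_(i < k) d i) ->
  delta * (t 0%N - t m) + (\sum_(i < m.+1) d i) * t m
    <= \sum_(i < m.+1) d i * t i.
Proof.
elim: m => [|m IH] ht hd; first by rewrite subrr mulr0 add0r !big_ord1.
rewrite [leRHS]big_ord_recr [X in _ + X * _]big_ord_recr /=.
have {}IH : delta * (t 0%N - t m) + (\sum_(i < m.+1) d i) * t m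
    <= \sum_(i < m.+1) d i * t i.
  apply: IH => [i im|k /andP[k0 km]]; first by apply: ht; apply: ltnW.
  by apply: hd; rewrite k0 leqW.
have hm := ht m (ltnSn m).
have hD : delta <= \sum_(i < m.+1) d i by apply: hd; rewrite leqnn.
move: IH; set D := \sum_(i < m.+1) d i in hD *; set S := \sum_(i < m.+1) _.
by move=> IH; nra.
Qed.

Lemma expR_lin_derive (R : realType) (c a x : R) :
  is_derive x 1 (fun s => expR (c + s * a)) (a * expR (c + x * a)).
Proof.
have -> : (fun s => expR (c + s * a)) = expR \o (cst c + (a \*: id)).
  by apply/funext => s /=; congr expR; rewrite /GRing.scale /= mulrC.
have dlin : is_derive x 1 (cst c + (a \*: id)) (0 + a *: (1 : R)).
  exact: is_deriveD.
have -> : a * expR (c + x * a) =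
    expR ((cst c + (a \*: id)) x) * (0 + a *: (1 : R)).
  by rewrite /GRing.scale /= add0r mulr1 mulrC [x * a]mulrC.
exact: is_derive1_comp.
Qed.

(** A sum of exponentials of linear forms [theta |-> \sum_e a i e * theta e]
    has a critical point as soon as the largest of these forms controls the
    spread of [theta]: modulo constants, on which all the forms vanish, the sum
    is coercive, so it attains its minimum. *)
Lemma exp_sum_critical_point (R : realType) (I E : finType) (P : pred I)
    (a : I -> E -> R) (delta : R) :
    0 < delta -> (forall i, P i -> \sum_e a i e = 0) ->
    (forall theta : E -> R, exists2 i, P i &
       forall e f, delta * (theta e - theta f) <= \sum_g a i g * theta g) ->
  exists theta : E -> R,
    forall e, \sum_(i | P i) a i e * expR (\sum_f a i f * theta f) = 0.
Proof.
move=> delta0 a0 coerc.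
pose T := {ptws E -> R}.
pose F (th : T) := \sum_(i | P i) expR (\sum_f a i f * th f).
case: (pickP (@predT E)) => [e0 _|E0]; last first.
  by exists (fun=> 0) => e; have := E0 e.
have F_ge th e f : delta * (th e - th f) < F th.
  have [i Pi hi] := coerc th.
  rewrite /F (bigD1 i) //=; apply: ltr_wpDr.
    by apply: sumr_ge0 => j _; apply: expR_ge0.
  apply: le_lt_trans (hi e f) _; apply: lt_le_trans (expR_ge1Dx _).
  by rewrite ltrDr.
have F_shift th c : F (fun e => th e - c) = F th.
  apply: eq_bigr => i Pi; congr expR.
  under eq_bigr do rewrite mulrBr.
  by rewrite sumrB -mulr_suml a0 // mul0r subr0.
(* If [th] vanishes somewhere and exceeds [B] elsewhere, then [F th] exceeds
   the value of [F] at [0]. *)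
pose B := F (fun=> 0) / delta.
have B0 : 0 <= B.
  apply: divr_ge0 (ltW delta0); apply: sumr_ge0 => i _; exact: expR_ge0.
pose K : set T := [set th : T | forall e, `[0, B]%classic (th e)]%classic.
have cK : compact K.
  apply: (@tychonoff _ (fun=> R) (fun=> `[0, B]%classic)) => e.
  exact: segment_compact.
have K0 : (K !=set0)%classic.
  by exists (fun=> 0) => e /=; rewrite in_itv /= lexx.
have cF : continuous F.
  have add_c : continuous (fun z : R * R => z.1 + z.2) by exact: add_continuous.
  apply: (@continuous_big R I +%R 0 P add_c T (index_enum I)
    (fun i th => expR (\sum_f a i f * th f))) => i _ th.
  apply: (@continuous_comp T R R (fun th : T => \sum_f a i f * th f) expR);
    last exact: continuous_expR.
  apply: (@continuous_big R E +%R 0 predT add_c T (index_enum E)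
    (fun f th => a i f * th f)) => f _ th'.
  have pc : continuous (fun th : T => th f).
    exact: (@proj_continuous E (fun=> R) f).
  exact: (@continuous_comp T R R (fun th : T => th f) ( *%R (a i f)) th'
    (pc th') (@mulrl_continuous R (a i f) (th' f))).
have [th0 /set_mem thK minK] := compact_EVT_min K0 cK (continuous_subspaceT cF).
have minF th : F th0 <= F th.
  (* Translate [th] so that its least value is 0. *)
  case: (arg_minP th (isT : predT e0)) => e1 _ e1min.
  rewrite -(F_shift th (th e1)).
  have [inK|] := pselect (K (fun e => th e - th e1)).
    by apply: minK; apply/mem_set.
  move=> /existsNP[e]; rewrite /= in_itv /= subr_ge0 e1min //= => /negP.
  rewrite -ltNge ltr_pdivrMr // mulrC => he.
  rewrite F_shift; apply: le_trans (minK (fun=> 0) _) _; last first.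
    by apply: ltW; apply: lt_trans he _; apply: F_ge.
  by apply/mem_set => f /=; rewrite in_itv /= lexx.
exists th0 => e.
pose phi (s : R) := \sum_(i | P i) expR (\sum_f a i f * th0 f + s * a i e).
have phiE s : phi s = F (fun f => th0 f + s * (f == e)%:R).
  apply: eq_bigr => i _; congr expR.
  under [RHS]eq_bigr do rewrite mulrDr.
  rewrite big_split /=; congr (_ + _).
  rewrite (bigD1 e) //= eqxx mulr1 mulrC big1 ?addr0 // => f /negPf->.
  by rewrite !mulr0.
have dphi (s : R) : is_derive s 1 phi
    (\sum_(i | P i) a i e * expR (\sum_f a i f * th0 f + s * a i e)).
  have -> : phi = \sum_(i | P i)
      (fun s => expR (\sum_f a i f * th0 f + s * a i e)).
    by apply/funext => r; rewrite fct_sumE.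
  elim/big_ind2: _ => [|g dg h dh Hg Hh|i _].
  - exact: is_derive_cst.
  - exact: is_deriveD.
  - exact: expR_lin_derive.
have dphi0 : is_derive (0 : R) 1 phi 0.
  apply: (@derive1_at_min R phi (-1) 1 0) => [||| t _].
  - by lra.
  - by move=> t _; case: (dphi t).
  - by rewrite in_itv /=; apply/andP; split; lra.
  - rewrite !phiE; have -> : (fun f => th0 f + 0 * (f == e)%:R) = th0.
      by apply/funext => f; rewrite mul0r addr0.
    exact: minF.
have := @derive_val _ _ _ _ _ _ _ dphi0.
rewrite (@derive_val _ _ _ _ _ _ _ (dphi 0)) => dE; rewrite -[RHS]dE.
by apply: eq_bigr => i _; rewrite mul0r addr0.
Qed.

(** * From density to homogeneity and biconnectedness *)

Lemma sum_mem_card (R : realType) (T : finType) (A B : {set T}) :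
  \sum_(x in B) (x \in A)%:R = #|A :&: B|%:R :> R.
Proof.
rewrite -sum1_card natr_sum big_mkcond [RHS]big_mkcond /=.
by apply: eq_bigr => x _; rewrite inE; case: (x \in A); case: (x \in B).
Qed.

Lemma finite_pos_lower_bound (R : realType) (I : finType) (P : pred I)
    (f : I -> R) :
    (forall i, P i -> 0 < f i) ->
  exists2 delta, 0 < delta & forall i, P i -> delta <= f i.
Proof.
move=> f0; case: (pickP P) => [i0 Pi0|P0]; last first.
  by exists 1 => // i; rewrite P0.
case: (arg_minP f Pi0) => i Pi fi.
by exists (f i); [exact: f0|exact: fi].
Qed.

Lemma rank_sum_components (R : realType) (G : multigraph) (F : {set edge G}) :
  (graph_rank F)%:R = \sum_(C in components F) (#|C|%:R - 1) :> R.
Proof.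
rewrite sumrB sumr_const -natr_sum.
have -> : (\sum_(C in components F) #|C| = #|vertex G|)%N.
  rewrite -[RHS]sum1_card (partition_big (component F) (mem (components F)));
    last by move=> x _; apply: imset_f.
  apply: eq_bigr => _ /imsetP[y _ ->]; rewrite -sum1_card; apply: eq_bigl => x.
  by rewrite inE eq_sym component_eq.
by rewrite -(rank_components F) natrD addrK.
Qed.

(** Every edge of [F] at a vertex of a component stays inside it, so a component
    with at least one edge has no isolated vertex. *)
Lemma component_edge_induced (G : multigraph) (F : {set edge G}) x e0 :
  let FC := [set e in F | ends e \subset component F x] in
  e0 \in FC -> connected_edge_induced (component F x, FC).
Proof.
move=> FC e0C; have [e0F e0x] : e0 \in F /\ ends e0 \subset component F x.
  by move: e0C; rewrite inE => /andP[].
have FCin e a : e \in F -> a \in ends e -> a \in component F x -> e \in FC.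
  move=> eF ae aC; rewrite inE eF; apply/subsetP=> b be.
  rewrite inE in aC; rewrite inE.
  by apply: connect_trans aC (adjacent_by_ends eF ae be).
split; last by apply/card_gt0P; exists e0.
- apply/setP=> y /=; apply/idP/bigcupP => [yC|[e]]; last first.
    by rewrite inE => /andP[_ /subsetP eC] /eC.
  have [a [b [_ e0E]]] := ends_pair e0.
  have ae0 : a \in ends e0 by rewrite e0E set21.
  have : connect (adjacent_by F) y a.
    have /subsetP/(_ a ae0) := e0x; rewrite !inE in yC *.
    by apply: connect_trans; rewrite connect_adjacent_sym.
  case/connectP=> [[|z p]] /=; first by move=> _ <-; exists e0.
  move=> /andP[/adjacent_byP[e [eF ye _]] _] _; exists e => //.
  exact: FCin eF ye yC.
- split=> /=; first by apply/set0Pn; exists x; apply: component_refl.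
  move=> y z yC zC.
  have cyz : connect (adjacent_by F) y z.
    rewrite !inE in yC zC; apply: connect_trans zC.
    by rewrite connect_adjacent_sym.
  suff : z \in component F y :&: [set z | connect (adjacent_by FC) y z].
    by rewrite !inE => /andP[].
  apply: (connect_invariant _ cyz); last by rewrite !inE !connect0.
  move=> e a b eF ae be; rewrite !inE => /andP[ya ya'].
  rewrite (connect_trans ya (adjacent_by_ends eF ae be)) /=.
  apply: connect_trans ya' _; apply: (adjacent_by_ends _ ae be).
  apply: FCin eF ae _; rewrite !inE in yC *; exact: connect_trans yC ya.
Qed.

Lemma vertex_gt1 (G : multigraph) (e : edge G) : (1 < #|vertex G|)%N.
Proof. by have := max_card (mem (ends e)); rewrite card_ends. Qed.

Lemma vertex_sub1_gt0 (R : realType) (G : multigraph) (e : edge G) :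
  0 < #|vertex G|%:R - 1 :> R.
Proof. by rewrite subr_gt0 ltr1n (vertex_gt1 e). Qed.

Lemma theta_whole (R : realType) (G : multigraph) (beta : edge G -> R) :
  prob_mass beta -> theta beta (whole_graph G) = (#|vertex G|%:R - 1)^-1.
Proof.
case=> _ b1; rewrite /theta /= cardsT big_mkcond /=.
under eq_bigr do rewrite inE.
by rewrite b1 mul1r.
Qed.

(** Both sides split into sums over the components of [F]. A component without
    edges is a single vertex and contributes 0 to each; density applies to the
    others. *)
Lemma dense_rank_lt (R : realType) (G : multigraph) (beta : edge G -> R)
    (F : {set edge G}) :
    prob_mass beta -> strictly_dense beta -> F != set0 -> F != [set: edge G] ->
  (#|vertex G|%:R - 1) * (\sum_(e in F) beta e) < (graph_rank F)%:R.
Proof.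
move=> hb dense /set0Pn[e0 e0F] FT.
have n0 := vertex_sub1_gt0 R e0.
have /choice[h hE] : forall e : edge G, exists x, x \in ends e.
  by move=> e; have [a [b [_ ->]]] := ends_pair e; exists a; rewrite set21.
rewrite (partition_big (fun e => component F (h e)) (mem (components F))) /=;
  last by move=> e _; apply: imset_f.
rewrite rank_sum_components mulr_sumr.
have FCE x : [set e in F | component F (h e) == component F x] =
    [set e in F | ends e \subset component F x].
  apply/setP=> e; rewrite !inE; case: (boolP (e \in F)) => //= eF.
  apply/eqP/subsetP => [<- y ye|/(_ _ (hE e))].
    by rewrite inE; apply: adjacent_by_ends eF (hE e) ye.
  by rewrite inE connect_adjacent_sym -component_eq => /eqP.
have lt_comp x e1 : e1 \in [set e in F | ends e \subset component F x] ->
    (#|vertex G|%:R - 1) *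
      (\sum_(e in F | component F (h e) == component F x) beta e)
      < #|component F x|%:R - 1.
  move=> e1C; have C1 : 0 < #|component F x|%:R - 1 :> R.
    move: e1C; rewrite inE subr_gt0 ltr1n => /andP[_ /subset_leq_card].
    by rewrite card_ends.
  have neW : (component F x, [set e in F | ends e \subset component F x])
      <> whole_graph G.
    case=> _ FCT; case/negP: FT; rewrite eqEsubset subsetT /= -FCT.
    by apply/subsetP=> e; rewrite inE => /andP[].
  have := dense _ (component_edge_induced e1C) neW.
  rewrite theta_whole // /theta /= -FCE ltr_pdivrMr // ltr_pdivlMl //.
  congr (_ * _ < _); apply: eq_bigl => e.
  by rewrite inE.
have e0C : e0 \in [set e in F | ends e \subset component F (h e0)].
  by rewrite -FCE inE e0F eqxx.
have C0 : component F (h e0) \in components F by apply: imset_f.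
rewrite (bigD1 _ C0) [ltRHS](bigD1 _ C0) /=.
apply: ltr_leD; first exact: lt_comp e0C.
apply: ler_sum => _ /andP[/imsetP[x _ ->] _].
have [FC0|/set0Pn[e1 e1C]] :=
  eqVneq [set e in F | ends e \subset component F x] set0.
  rewrite big1 ?mulr0 => [|e /andP[eF eC]]; last first.
    have : e \in [set e in F | ends e \subset component F x].
      by rewrite -FCE inE eF eC.
    by rewrite FC0 inE.
  rewrite subr_ge0 ler1n; apply/card_gt0P; exists x; exact: component_refl.
exact/ltW/(lt_comp _ _ e1C).
Qed.

Lemma incident_edge (G : multigraph) (x y : vertex G) :
  graph_connected G -> x != y -> exists e : edge G, x \in ends e.
Proof.
case=> _ /(_ x y (in_setT _) (in_setT _))/connectP[[|z p]] /=.
  by move=> _ ->; rewrite eqxx.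
by move=> /andP[/adjacent_byP[e [_ xe _]] _] _ _; exists e.
Qed.

Lemma dense_biconnected (R : realType) (G : multigraph) (beta : edge G -> R) :
  graph_connected G -> prob_mass beta -> strictly_dense beta ->
  graph_biconnected G.
Proof.
move=> cG hb dense; split=> // v [x [y [xv yv _ nxy]]].
(* In [delete_vertex v], [A] is the component of [x]; the edges of [F] have
   their ends in [v |: A], the others have theirs in [~: A]. *)
pose A := component (delete_vertex v).2 x.
pose F := [set e : edge G | ends e :&: A != set0].
have vA : v \notin A.
  apply/negP; rewrite inE connect_adjacent_sym => vx.
  suff : x \in [set v] by rewrite inE (negPf xv).
  apply: (connect_invariant _ vx (set11 v)) => e a b.
  by rewrite !inE => ve ae _ /eqP av; rewrite -av ae in ve.
have yA : y \notin A by rewrite inE.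
have FA e : e \in F -> ends e \subset v |: A.
  rewrite inE => /set0Pn[a /setIP[ae aA]]; apply/subsetP=> b be.
  rewrite !inE; have [//|bv] := eqVneq b v; rewrite /= -/A.
  have [ve|ve] := boolP (v \in ends e).
    have [p [q [pq eE]]] := ends_pair e.
    have av : a != v by apply: contraNneq vA => <-.
    suff -> : b = a by move: aA; rewrite inE.
    move: ae be ve av bv; rewrite eE !inE.
    by do 3 case/orP=> /eqP->; rewrite ?eqxx.
  move: aA; rewrite inE => xa; apply: connect_trans xa _.
  by apply: (adjacent_by_ends _ ae be); rewrite inE.
have [ex xex] : exists e : edge G, x \in ends e.
  by apply: incident_edge cG xv.
have [ey yey] : exists e : edge G, y \in ends e.
  by apply: incident_edge cG yv.
have F0 : F != set0.
  apply/set0Pn; exists ex; rewrite inE; apply/set0Pn; exists x.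
  by rewrite inE xex component_refl.
have eyF : ey \notin F.
  by apply: contra yA => /FA/subsetP/(_ y yey); rewrite !inE (negPf yv).
have FT : F != setT by apply: contraNneq eyF => ->; rewrite inE.
have CF0 : ~: F != set0 by apply/set0Pn; exists ey; rewrite inE.
have CFT : ~: F != setT.
  by apply: contraNneq F0 => FE; rewrite -(setCK F) FE setCT.
have := ltrD (dense_rank_lt hb dense F0 FT) (dense_rank_lt hb dense CF0 CFT).
rewrite -mulrDr.
have -> : \sum_(e in F) beta e + \sum_(e in ~: F) beta e = 1.
  rewrite -hb.2 [RHS](bigID (mem F)) /=; congr (_ + _).
  by apply: eq_bigl => e; rewrite inE.
rewrite mulr1 ltrBlDr -natrD -[X in _ + X]/(1%:R) -natrD ltr_nat.
have rF : (graph_rank F < #|v |: A|)%N.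
  by apply: rank_lt_support FA; apply/set0Pn; exists v; rewrite setU11.
have rCF : (graph_rank (~: F) < #|~: A|)%N.
  apply: rank_lt_support => [|e]; first by apply/set0Pn; exists y; rewrite inE.
  rewrite !inE negbK => /eqP eA; rewrite -disjoints_subset -setI_eq0 eA.
  exact: eqxx.
have := cardsC A; move: rF rCF; rewrite cardsU1 vA; clear; lia.
Qed.

Lemma spanning_treesE (G : multigraph) (g : {set edge G}) :
  reflect (spanning_tree g) (g \in spanning_trees G).
Proof. by rewrite inE; apply: asboolP. Qed.

Lemma sum_prefix (R : realType) (T : finType) (x0 : T) (s : seq T) (d : T -> R)
    k : uniq s -> (k <= size s)%N ->
  \sum_(i < k) d (nth x0 s i) = \sum_(x in [set:: take k s]) d x.
Proof.
move=> us ks; under [RHS]eq_bigl do rewrite inE.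
rewrite -big_uniq ?take_uniq //= (big_nth x0) size_takel // big_mkord.
by apply: eq_bigr => i _; rewrite nth_take.
Qed.

(** The tree [g] comes from Kruskal's algorithm on the edges in decreasing order
    of [theta]; the bound is summation by parts along the prefixes of this list. *)
Lemma greedy_tree_bound (R : realType) (G : multigraph) (eta : edge G -> R)
    (delta : R) :
    graph_connected G -> 0 <= delta -> \sum_e eta e = #|vertex G|%:R - 1 ->
    (forall F : {set edge G}, F != set0 -> F != [set: edge G] ->
       delta <= (graph_rank F)%:R - \sum_(e in F) eta e) ->
  forall theta : edge G -> R, exists2 g, g \in spanning_trees G
    & forall e f, delta * (theta e - theta f)
        <= \sum_h ((h \in g)%:R - eta h) * theta h.
Proof.
move=> cG delta0 eta1 hdelta theta.
pose s := sort (fun e f => theta f <= theta e) (enum (edge G)).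
have us : uniq s by rewrite sort_uniq enum_uniq.
have sT e : e \in s by rewrite mem_sort mem_enum.
have ss : sorted (fun e f => theta f <= theta e) s.
  by apply: sort_sorted => e f; apply: le_total.
have [g tg gk] := greedy_spanning_tree cG sT.
exists g; first exact/spanning_treesE.
move=> e f.
have m0 : (0 < size s)%N by case: (s) (sT e).
pose t i := theta (nth e s i); pose a h : R := (h \in g)%:R - eta h.
have tle i j : (i <= j < size s)%N -> t j <= t i.
  move=> /andP[ij js].
  have tr : transitive (fun e f => theta f <= theta e).
    by move=> x y z yx xz; apply: le_trans xz yx.
  have := sorted_leq_nth tr (fun x => lexx (theta x)) e ss; apply=> //.
  by rewrite inE (leq_ltn_trans ij).
have prefixE k : (k <= size s)%N ->
    \sum_(i < k) a (nth e s i) =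
    (graph_rank [set:: take k s])%:R - \sum_(h in [set:: take k s]) eta h.
  move=> ks; rewrite (sum_prefix e a us ks) sumrB.
  by rewrite (sum_mem_card R g [set:: take k s]) gk.
have sE : [set:: take (size s) s] = [set: edge G].
  by rewrite take_size; apply/setP=> h; rewrite !inE sT.
have sum0 : \sum_(i < size s) a (nth e s i) = 0.
  rewrite prefixE // sE; under eq_bigl do rewrite inE.
  rewrite eta1; have /rank_connected <- := cG.
  by rewrite -natr1 addrK subrr.
have -> : \sum_h a h * theta h = \sum_(i < size s) a (nth e s i) * t i.
  rewrite (sum_prefix e (fun h => a h * theta h) us) // sE.
  by apply: eq_bigl => h; rewrite inE.
have sz : size s = (size s).-1.+1 by rewrite prednK.
apply: (@le_trans _ _ (delta * (t 0%N - t (size s).-1))).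
  have tE h : theta h = t (index h s) by rewrite /t nth_index.
  have ti h : (index h s < size s)%N by rewrite index_mem.
  rewrite ler_wpM2l // (tE e) (tE f); apply: lerB; apply: tle.
    by rewrite leq0n ti.
  by rewrite -ltnS prednK // ti leqnn.
have := @abel_lower_bound R (fun i => a (nth e s i)) t delta (size s).-1.
rewrite -sz sum0 mul0r addr0; apply=> [i im|k /andP[k0 km]].
  by apply: tle; rewrite leqnSn sz.
rewrite prefixE; last by lia.
have sk : size (take k s) = k by rewrite size_takel //; lia.
have ck : #|[set:: take k s]| = k.
  by rewrite cardsE (card_uniqP _) ?take_uniq.
apply: hdelta; first by rewrite -cards_eq0 ck -lt0n.
apply/negP=> /eqP kT; move: ck; rewrite kT -sE take_size cardsE (card_uniqP us).
lia.
Qed.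


Lemma tree_weight_gt0 (R : realType) (G : multigraph) (sigma : edge G -> R) g :
  (forall e, 0 < sigma e) -> 0 < tree_weight sigma g.
Proof. by move=> s0; apply: prodr_gt0. Qed.

Lemma edge_marginalE (R : realType) (G : multigraph) (sigma : edge G -> R) e :
  edge_marginal (tree_pmf sigma) e =
  (\sum_(g in spanning_trees G) (e \in g)%:R * tree_weight sigma g) /
  \sum_(g in spanning_trees G) tree_weight sigma g.
Proof.
rewrite /edge_marginal /tree_pmf -mulr_suml big_mkcondr; congr (_ / _).
by apply: eq_bigr => g _; case: (e \in g); rewrite ?mul1r ?mul0r.
Qed.

Lemma expR_prod (R : realType) (I : finType) (P : pred I) (f : I -> R) :
  expR (\sum_(i | P i) f i) = \prod_(i | P i) expR (f i).
Proof. exact: (big_morph _ (@expRD R) (@expR0 R)). Qed.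

Lemma partition_function_gt0 (R : realType) (G : multigraph)
    (sigma : edge G -> R) :
    graph_connected G -> (forall e, 0 < sigma e) ->
  0 < \sum_(g in spanning_trees G) tree_weight sigma g.
Proof.
move=> cG s0; have [] := @greedy_spanning_tree G (enum (edge G)) cG.
  by move=> e; rewrite mem_enum.
move=> g /spanning_treesE gT _; rewrite (bigD1 g gT) /=.
apply: ltr_pwDl; first exact: tree_weight_gt0.
by apply: sumr_ge0 => h _; apply/ltW/tree_weight_gt0.
Qed.

Lemma dense_homogeneous (R : realType) (G : multigraph) (beta : edge G -> R) :
  graph_connected G -> prob_mass beta -> strictly_dense beta ->
  strictly_homogeneous beta.
Proof.
move=> cG hb dense.
pose N : R := #|vertex G|%:R - 1; pose eta e := N * beta e.
pose P F := (F != set0) && (F != [set: edge G]).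
have [delta delta0 hdelta] : exists2 delta, 0 < delta & forall F, P F ->
    delta <= (graph_rank F)%:R - \sum_(e in F) eta e.
  apply: finite_pos_lower_bound => F /andP[F0 FT].
  by rewrite subr_gt0 -mulr_sumr dense_rank_lt.
have eta1 : \sum_e eta e = N by rewrite -mulr_sumr hb.2 mulr1.
have [||theta crit] := @exp_sum_critical_point R _ _
    (mem (spanning_trees G)) (fun g e => (e \in g)%:R - eta e) delta delta0.
- move=> g /spanning_treesE/spanning_treeP[_ cg].
  rewrite sumrB eta1 /N -cg -natr1 addrK.
  have := @sum_mem_card R _ g setT; rewrite setIT => <-.
  by under [X in _ - X]eq_bigl do rewrite inE; rewrite subrr.
- apply: (greedy_tree_bound cG (ltW delta0) eta1) => F F0 FT.
  by apply: hdelta; rewrite /P F0 FT.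
pose sigma e := expR (theta e).
have s0 e : 0 < sigma e by apply: expR_gt0.
exists sigma; split=> // e; rewrite edge_marginalE.
set Z := \sum_(g in _) tree_weight sigma g.
have Z0 : 0 < Z := partition_function_gt0 cG s0.
have N0 : 0 < N := vertex_sub1_gt0 R e.
suff -> : \sum_(g in spanning_trees G) (e \in g)%:R * tree_weight sigma g =
    eta e * Z.
  by rewrite mulfK ?gt_eqF // /eta mulrC mulKf ?gt_eqF.
apply/eqP; rewrite -subr_eq0 mulr_sumr -sumrB.
under eq_bigr do rewrite -mulrBl.
(* The exponentials in [crit] are the tree weights up to this common factor. *)
apply/eqP; apply: (mulIf (x := expR (- \sum_f eta f * theta f))).
  by rewrite gt_eqF ?expR_gt0.
rewrite mul0r -[RHS](crit e) mulr_suml; apply: eq_bigr => g _.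
rewrite -mulrA; congr (_ * _).
rewrite /tree_weight -expR_prod -expRD; congr expR.
under [RHS]eq_bigr do rewrite mulrBl.
rewrite sumrB; congr (_ - _); rewrite big_mkcond /=.
by apply: eq_bigr => f _; case: (f \in g); rewrite ?mul1r ?mul0r.
Qed.

(** * From homogeneity and biconnectedness to density *)

(** By connectedness every component of [F] meets [W]. If each met [W] in a
    single vertex, then the one vertex of [W] in a component containing an edge
    of [F] would separate the rest of that component from the rest of [W]. *)
Lemma biconnected_components_lt (G : multigraph) (F : {set edge G})
    (W : {set vertex G}) :
    graph_biconnected G -> F != set0 -> (1 < #|W|)%N ->
    (forall e, e \notin F -> ends e \subset W) ->
  (#|components F| < #|W|)%N.
Proof.
move=> [cG noart] /set0Pn[e eF] W1 FW.
have cT x y : connect (adjacent_by [set: edge G]) x y.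
  by apply: cG.2; rewrite inE.
have meetW x : exists2 w, w \in W & connect (adjacent_by F) x w.
  have [w wW] : exists w, w \in W by apply/card_gt0P; apply: ltnW.
  case: (boolP [exists w in W, connect (adjacent_by F) x w]).
    by move/exists_inP.
  rewrite negb_exists_in => /forall_inP xW.
  have : w \in component F x.
    apply: (connect_invariant _ (cT x w));
      last exact: component_refl.
    move=> f a b _ af bf; rewrite !inE => xa.
    apply: (connect_trans xa (adjacent_by_ends _ af bf)).
    by apply: contraT => /FW/subsetP/(_ a af)/xW; rewrite xa.
  by rewrite inE (negPf (xW w wW)).
have cE : components F = component F @: W.
  apply/setP=> C; apply/imsetP/imsetP => [[x _ ->]|[x _ ->]]; last by exists x.
  have [w wW xw] := meetW x; exists w => //; apply/eqP.
  by rewrite component_eq.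
rewrite cE ltn_neqAle leq_imset_card andbT; apply/negP=> /imset_injP inj.
have injW v w : v \in W -> w \in W -> connect (adjacent_by F) v w -> v = w.
  by move=> vW wW vw; apply: inj => //; apply/eqP; rewrite component_eq.
have [a [b [ab eE]]] := ends_pair e.
have [v vW av] := meetW a.
have cs p q : connect (adjacent_by F) p q -> connect (adjacent_by F) q p.
  by rewrite connect_adjacent_sym.
have [w wv vw] : exists2 w, w != v & connect (adjacent_by F) v w.
  have [abv|abv] := eqVneq a v; last by exists a => //; apply: cs.
  exists b; first by rewrite -abv eq_sym.
  apply: connect_trans (cs _ _ av) (adjacent_by_ends eF _ _);
    by rewrite eE !inE eqxx ?orbT.
have wW : w \notin W by apply: (contra _ wv) => wW; rewrite (injW _ _ vW wW vw).
have [u] : exists u, u \in W :\ v.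
  by apply/card_gt0P; rewrite (cardsD1 v) vW in W1.
rewrite !inE => /andP[uv uW].
apply: (noart v); exists w, u; split=> //.
apply/negP=> wu.
have : u \in component F v :\ v.
  apply: (connect_invariant _ wu); last by rewrite !inE wv.
  move=> f p q; rewrite !inE => vf pf qf /andP[pv vp].
  have qv : q != v by apply: contraNneq vf => <-.
  rewrite qv /=; apply: (connect_trans vp (adjacent_by_ends _ pf qf)).
  apply: contraT => /FW/subsetP/(_ p pf) pW.
  by move: pv; rewrite (injW _ _ vW pW vp) eqxx.
by rewrite !inE uv => /(injW _ _ vW uW) vu; rewrite vu eqxx in uv.
Qed.

Lemma homogeneous_biconnected_dense (R : realType) (G : multigraph)
    (beta : edge G -> R) :
  prob_mass beta -> strictly_homogeneous beta -> graph_biconnected G ->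
  strictly_dense beta.
Proof.
move=> hb [sigma [s0 sE]] biG [V1 S] [VE _ S0] HG; have cG := biG.1.
rewrite /edge_induced /= in VE S0.
have [e0 e0S] : exists e, e \in S by apply/card_gt0P.
have N0 := vertex_sub1_gt0 R e0.
have SV e : e \in S -> ends e \subset V1.
  by move=> eS; rewrite VE; apply: bigcup_sup.
have V2 : (1 < #|V1|)%N.
  by have := subset_leq_card (SV e0 e0S); rewrite card_ends.
have V0 : V1 != set0 by rewrite -card_gt0 ltnW.
(* If [S] were the full edge set then, no vertex being isolated, the subgraph
   would be the whole graph. *)
have SC0 : ~: S != set0.
  apply: contra_not_neq HG => /(congr1 (@setC _)); rewrite setCK setC0 => ST.
  rewrite /whole_graph ST; congr pair; apply/setP=> x; rewrite inE VE ST.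
  have [y xy] : exists y, x != y.
    have [a [b [ab _]]] := ends_pair e0.
    by have [xa|] := eqVneq x a; [exists b; rewrite xa|exists a].
  have [e xe] := incident_edge cG xy.
  by apply/bigcupP; exists e; rewrite ?inE.
set Z := \sum_(g in spanning_trees G) tree_weight sigma g.
have Z0 : 0 < Z := partition_function_gt0 cG s0.
have c0 : 0 < #|V1|%:R - 1 :> R by rewrite subr_gt0 ltr1n.
rewrite theta_whole // /theta /= ltr_pdivrMr // ltr_pdivlMl // mulr_sumr.
have -> : \sum_(e in S) (#|vertex G|%:R - 1) * beta e =
    (\sum_(g in spanning_trees G) tree_weight sigma g * #|g :&: S|%:R) / Z.
  under eq_bigr do rewrite -sE mulrC divfK ?gt_eqF // edge_marginalE.
  rewrite -mulr_suml exchange_big /=; congr (_ / _); apply: eq_bigr => g _.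
  by rewrite -mulr_suml sum_mem_card mulrC.
rewrite ltr_pdivrMr // mulr_sumr.
have cardS g : g \in spanning_trees G -> (#|g :&: S| < #|V1|)%N.
  move=> /spanning_treesE[_ ag].
  rewrite -(rank_acyclic (edge_acyclicS (subsetIl g S) ag)).
  by apply: rank_lt_support => // e /setIP[_ /SV].
(* A tree that prefers the edges outside [S] makes the inequality strict. *)
have [|g gT gk] := @greedy_spanning_tree G (enum (~: S) ++ enum S) cG.
  by move=> e; rewrite mem_cat !mem_enum inE orNb.
have gS : (#|g :&: S|.+1 < #|V1|)%N.
  have := gk (size (enum (~: S))); rewrite take_size_cat //.
  have -> : [set:: enum (~: S)] = ~: S by apply/setP=> e; rewrite inE mem_enum.
  have [_ cg] := (spanning_treeP g).1 gT.
  have cV : (#|components (~: S)| < #|V1|)%N.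
    apply: biconnected_components_lt => // e; rewrite inE negbK; exact: SV.
  move: cV cg (rank_components (~: S)) (cardsID S g); rewrite setDE; lia.
have {}gT : g \in spanning_trees G by apply/spanning_treesE.
rewrite (bigD1 g gT) [ltRHS](bigD1 g gT) /=.
have le_nat m : (m < #|V1|)%N -> m%:R <= #|V1|%:R - 1 :> R.
  by move=> mV; rewrite lerBrDr natr1 ler_nat.
apply: ltr_leD.
  rewrite mulrC ltr_pM2r ?tree_weight_gt0 //.
  by rewrite ltrBrDr natr1 ltr_nat.
apply: ler_sum => h /andP[hT _]; rewrite mulrC ler_pM2r ?tree_weight_gt0 //.
exact/le_nat/cardS.
Qed.

Theorem lemma1p14 (R : realType) (G : multigraph) (beta : edge G -> R)
    (hG : graph_connected G) (hbeta : prob_mass beta) :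
  strictly_dense beta <-> strictly_homogeneous beta /\ graph_biconnected G.
Proof.
split=> [dense|[hom biG]].
  split; [exact: dense_homogeneous|exact: dense_biconnected dense].
exact: homogeneous_biconnected_dense.
Qed.
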